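(* Let $(\mu_n)_{n=1}^\infty$ be a sequence of unimodular probability measures on $\mathbf{Gr}$ that converges weakly to a probability measure $\mu$ on $\mathbf{Gr}$. Then $\mu$ is unimodular.
   Context: Fix a positive integer $\Delta$. All graphs are simple and undirected; $\mathbb{N}=\{0,1,2,\dots\}$. For a graph $G$, $N_G(o)$ is the set of vertices adjacent to $o$, and $B_G(o,r)$ is the subgraph induced by the vertices at graph distance at most $r$ from $o$ (within the connected component of $o$). A rooted graph is a pair $(G,o)$ with $o\in V(G)$; a birooted graph is a triple $(G,o_1,o_2)$ with $o_1\in V(G)$, $o_2\in N_G(o_1)$; isomorphisms must preserve the roots (in order). $\mathbf{Gr}$ is the set of isomorphism classes $[G,o]$ of countable connected rooted graphs with all degrees at most $\Delta$, with the metric $\rho([G,o],[H,p])=0$ if $[G,o]=[H,p]$ and $2^{-r}$ otherwise, where $r=\sup\{s\in\mathbb{N}: [B_G(o,s),o]=[B_H(p,s),p]\}$. $\vec{\mathbf{Gr}}$ is the set of isomorphism classes $[G,o_1,o_2]$ of countable connected birooted graphs with all degrees at most $\Delta$, with the metric $\vec\rho([G,o_1,o_2],[H,p_1,p_2])=0$ if the classes are equal and $2^{-r}$ otherwise, where $r=\sup\{s\in\mathbb{N}: [B_G(o_1,s),o_1,o_2]=[B_H(p_1,s),p_1,p_2]\}$ (the condition for $s=0$ is regarded as always satisfied). Both are compact ultrametric spaces, equipped with their Borel $\sigma$-algebras. A probability measure $\mu$ on $\mathbf{Gr}$ is unimodular if $$\int \sum_{x\in N_G(o)} f[G,x,o]\,d\mu[G,o]=\int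 \sum_{x\in N_G(o)} f[G,o,x]\,d\mu[G,o]$$ for all nonnegative real-valued Borel functions $f$ on $\vec{\mathbf{Gr}}$. A sequence $(\mu_n)$ converges weakly to $\mu$ if $\int f\,d\mu_n\to\int f\,d\mu$ for all continuous $f:\mathbf{Gr}\to\mathbb{R}$. *)

(* Defs.v *)
From HB Require Import structures.
From mathcomp Require Import all_boot all_order all_algebra.
From mathcomp Require Import generic_quotient.
From mathcomp Require Import all_classical all_reals all_analysis.

Set Implicit Arguments.
Unset Strict Implicit.
Unset Printing Implicit Defensive.

Import Order.TTheory GRing.Theory Num.Theory.
Import numFieldNormedType.Exports.

Local Open Scope classical_set_scope.
Local Open Scope ring_scope.
Local Open Scope quotient_scope.

(** * Countable simple graphs *)

(* Every countable simple graph is isomorphic to one whose vertex set is a set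
   of natural numbers; only isomorphism classes matter below. *)
Record graph := Graph {
  vert : set nat ;
  adj : rel nat ;
  adj_sym : symmetric adj ;
  adj_irr : irreflexive adj ;
  adj_vert : forall x y, adj x y -> vert x }.

Definition nbr (G : graph) (o : nat) : set nat := [set x | adj G o x].

(* [within G s x y]: the graph distance from x to y is at most s. *)
Definition within (G : graph) (s : nat) (x y : nat) : Prop :=
  exists p : seq nat, [/\ path (adj G) x p, last x p = y & (size p <= s)%N].

Definition connected_graph (G : graph) : Prop :=
  forall x y, vert G x -> vert G y -> exists s, within G s x y.

Definition degree_le (Delta : nat) (G : graph) : Prop :=
  forall x, vert G x -> (nbr G x #<= `I_Delta)%card.

Section induced.
Context (G : graph) (A : set nat).

Let adjA : rel nat := [rel x y | [&& adj G x y, x \in A & y \in A]].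

Let adjA_sym : symmetric adjA.
Proof.
by move=> x y; rewrite /adjA /= adj_sym [in RHS]andbCA [RHS]andbC -andbA andbC
  -andbA.
Qed.

Let adjA_irr : irreflexive adjA.
Proof. by move=> x; rewrite /adjA /= adj_irr. Qed.

Let adjA_vert x y : adjA x y -> (vert G `&` A) x.
Proof. by move=> /and3P[/adj_vert Gx /set_mem Ax _]; split. Qed.

Definition induced : graph := Graph adjA_sym adjA_irr adjA_vert.

End induced.

Definition gball (G : graph) (o : nat) (s : nat) : graph :=
  induced G [set x | within G s o x].

Definition graph_iso (f : nat -> nat) (G H : graph) : Prop :=
  set_bij (vert G) (vert H) f /\
  forall x y, vert G x -> vert G y -> adj H (f x) (f y) = adj G x y.

Definition iso1 (G : graph) (o : nat) (H : graph) (p : nat) : Prop :=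
  exists f, graph_iso f G H /\ f o = p.

Definition iso2 (G : graph) (o1 o2 : nat) (H : graph) (p1 p2 : nat) : Prop :=
  exists f, [/\ graph_iso f G H, f o1 = p1 & f o2 = p2].

(** * Rooted and birooted graphs *)

Record rooted (Delta : nat) := Rooted {
  rgraph :> graph ;
  root : nat ;
  root_vert : vert rgraph root ;
  rooted_connected : connected_graph rgraph ;
  rooted_degree : degree_le Delta rgraph }.

Record birooted (Delta : nat) := Birooted {
  bgraph :> graph ;
  root1 : nat ;
  root2 : nat ;
  root_adj : adj bgraph root1 root2 ;
  birooted_connected : connected_graph bgraph ;
  birooted_degree : degree_le Delta bgraph }.

Arguments rooted_connected {Delta} r : rename.
Arguments rooted_degree {Delta} r : rename.
Arguments birooted_connected {Delta} b : rename.
Arguments birooted_degree {Delta} b : rename.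

HB.instance Definition _ (Delta : nat) := gen_eqMixin (rooted Delta).
HB.instance Definition _ (Delta : nat) := gen_choiceMixin (rooted Delta).
HB.instance Definition _ (Delta : nat) := gen_eqMixin (birooted Delta).
HB.instance Definition _ (Delta : nat) := gen_choiceMixin (birooted Delta).

Definition rooted_iso (Delta : nat) : rel (rooted Delta) :=
  [rel G H : rooted Delta | `[< iso1 G (root G) H (root H) >]].

Definition birooted_iso (Delta : nat) : rel (birooted Delta) :=
  [rel G H : birooted Delta | `[< iso2 G (root1 G) (root2 G) H (root1 H) (root2 H) >]].

(** * Isomorphisms *)

Lemma adj_vertr (G : graph) x y : adj G x y -> vert G y.
Proof. by rewrite adj_sym; exact: adj_vert. Qed.

Lemma graph_iso_id (G : graph) : graph_iso id G G.
Proof. by split => //; split => // x Gx; exists x. Qed.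

Lemma graph_iso_comp (G H K : graph) f g :
  graph_iso f G H -> graph_iso g H K -> graph_iso (g \o f) G K.
Proof.
move=> [fb fa] [gb ga]; split; first exact: set_bij_comp fb gb.
move=> x y Gx Gy /=; rewrite ga ?fa//; case: fb => fH _ _.
- exact: fH.
- exact: fH.
Qed.

Lemma graph_iso_inv (G H : graph) f : graph_iso f G H ->
  exists g, [/\ graph_iso g H G, (forall x, vert G x -> g (f x) = x)
            & forall y, vert H y -> f (g y) = y].
Proof.
move=> [[fH finj fsurj] fa].
have /choice[g gP] : forall y, exists x, vert H y -> vert G x /\ f x = y.
  move=> y; have [Hy|nHy] := pselect (vert H y); last by exists 0%N.
  by have [x Gx fx] := fsurj _ Hy; exists x.
have fV x : vert G x -> vert H (f x) by move=> Gx; exact: fH.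
have gfK x : vert G x -> g (f x) = x.
  move=> Gx; have [Gg fg] := gP _ (fV _ Gx).
  by apply: finj; rewrite ?inE.
have fgK y : vert H y -> f (g y) = y by move=> /gP[].
exists g; split => //; split.
  split.
  - by move=> y Hy; have [] := gP _ Hy.
  - move=> y z; rewrite !inE => Hy Hz gyz.
    by rewrite -(fgK _ Hy) -(fgK _ Hz) gyz.
  - by move=> x Gx; exists (f x); [exact: fV|exact: gfK].
by move=> y z Hy Hz; rewrite -fa ?fgK//; [have [] := gP _ Hy|have [] := gP _ Hz].
Qed.

Lemma iso1_refl G o : iso1 G o G o.
Proof. by exists id; split => //; exact: graph_iso_id. Qed.

Lemma iso1_trans G o H p K q : iso1 G o H p -> iso1 H p K q -> iso1 G o K q.
Proof.
move=> [f [fi <-]] [g [gi <-]]; exists (g \o f); split => //.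
exact: graph_iso_comp fi gi.
Qed.

Lemma iso1_sym G o H p : vert G o -> iso1 G o H p -> iso1 H p G o.
Proof.
move=> Go [f [/graph_iso_inv[g [gi gf _]] <-]].
by exists g; split => //; exact: gf.
Qed.

Lemma iso2_refl G o1 o2 : iso2 G o1 o2 G o1 o2.
Proof. by exists id; split => //; exact: graph_iso_id. Qed.

Lemma iso2_trans G o1 o2 H p1 p2 K q1 q2 :
  iso2 G o1 o2 H p1 p2 -> iso2 H p1 p2 K q1 q2 -> iso2 G o1 o2 K q1 q2.
Proof.
move=> [f [fi <- <-]] [g [gi <- <-]]; exists (g \o f); split => //.
exact: graph_iso_comp fi gi.
Qed.

Lemma iso2_sym G o1 o2 H p1 p2 : vert G o1 -> vert G o2 ->
  iso2 G o1 o2 H p1 p2 -> iso2 H p1 p2 G o1 o2.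
Proof.
move=> Go1 Go2 [f [/graph_iso_inv[g [gi gf _]] <- <-]].
by exists g; split => //; exact: gf.
Qed.

(** * Balls *)

Lemma within_refl G s x : within G s x x.
Proof. by exists [::]. Qed.

Lemma within_le G s t x y : (s <= t)%N -> within G s x y -> within G t x y.
Proof.
by move=> st [p [xp py ps]]; exists p; split => //; exact: leq_trans st.
Qed.

Lemma within_step G s x y z : within G s x y -> adj G y z -> within G s.+1 x z.
Proof.
move=> [p [xp py ps]] yz; exists (rcons p z).
by rewrite rcons_path last_rcons size_rcons xp py.
Qed.

Lemma within0 G x y : within G 0 x y -> y = x.
Proof. by move=> [[|? ?] [//= _ ->]]. Qed.

Lemma withinS G s x y : within G s.+1 x y ->
  within G s x y \/ exists2 z, within G s x z & adj G z y.
Proof.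
move=> [p]; elim/last_ind: p => [|p z _] [xp py ps].
  by left; exists [::].
rewrite last_rcons in py; subst z.
move: xp; rewrite rcons_path => /andP[xp zy].
by right; exists (last x p) => //; exists p; split; rewrite // -ltnS -(size_rcons p y).
Qed.

Lemma gball_root G o s : vert G o -> vert (gball G o s) o.
Proof. by move=> Go; split => //; exact: within_refl. Qed.

Lemma gball_nbr G o s x : (0 < s)%N -> adj G o x -> vert (gball G o s) x.
Proof.
move=> s0 ox; split; first exact: adj_vertr ox.
by exists [:: x]; rewrite /= ox.
Qed.

Lemma adj_gball G o s x y : vert (gball G o s) x -> vert (gball G o s) y ->
  adj (gball G o s) x y = adj G x y.
Proof. by move=> [_ /mem_set xs] [_ /mem_set ys]; rewrite /= xs ys !andbT. Qed.

Lemma within_iso G H o p n f : vert G o ->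
    graph_iso f (gball G o n) (gball H p n) -> f o = p ->
  forall s x, (s <= n)%N -> within G s o x -> within H s p (f x).
Proof.
move=> Go + fo; subst p => -[[fH _ _] fa]; elim=> [|s IH] x sn.
  by move=> /within0 ->; exact: within_refl.
move=> /withinS[xs|[z zs zx]].
  by apply: (within_le (leqnSn s)); apply: IH => //; exact: ltnW.
apply: (within_step (IH _ (ltnW sn) zs)).
have Bz : vert (gball G o n) z.
  by split; [exact: adj_vert zx|exact: (within_le (ltnW sn))].
have Bx : vert (gball G o n) x.
  by split; [exact: adj_vertr zx|apply: (within_le sn); exact: within_step zx].
by rewrite -(@adj_gball H (f o) n) ?fa ?adj_gball//; exact: fH.
Qed.

Lemma gball_iso_le G H o p n m f : vert G o -> (m <= n)%N ->
  graph_iso f (gball G o n) (gball H p n) -> f o = p ->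
  graph_iso f (gball G o m) (gball H p m).
Proof.
move=> Go mn fi fo.
have [g [gi gf fg]] := graph_iso_inv fi.
have [[fH finj fsurj] fa] := fi.
have fV x : vert (gball G o n) x -> vert (gball H p n) (f x).
  by move=> ?; exact: fH.
have Hp : vert H p.
  by have [] : vert (gball H p n) p by rewrite -[X in vert _ X]fo; apply: fV; exact: gball_root.
have go : g p = o by rewrite -fo gf//; exact: gball_root.
have mnG x : vert (gball G o m) x -> vert (gball G o n) x.
  by move=> [Gx xm]; split => //; exact: within_le xm.
have mnH x : vert (gball H p m) x -> vert (gball H p n) x.
  by move=> [Gx xm]; split => //; exact: within_le xm.
have fm x : vert (gball G o m) x -> vert (gball H p m) (f x).
  move=> Bx; have [Hfx _] := fV _ (mnG _ Bx); split => //.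
  by apply: (within_iso Go fi fo mn); case: Bx.
split.
  split.
  - by move=> x Bx; exact: fm.
  - by move=> x y; rewrite !inE => Bx By; apply: finj; rewrite inE; exact: mnG.
  - move=> y By; have := mnH _ By => Bny.
    exists (g y); last exact: fg.
    have [[gG _ _] _] := gi.
    have [Ggy _] : vert (gball G o n) (g y) by exact: gG.
    by split => //; apply: (within_iso Hp gi go mn); case: By.
move=> x y Bx By; rewrite (adj_gball (fm _ Bx) (fm _ By)) (adj_gball Bx By).
by rewrite -(adj_gball (fV _ (mnG _ Bx)) (fV _ (mnG _ By))) fa ?adj_gball//; exact: mnG.
Qed.

Lemma gball_finite Delta G o s : degree_le Delta G -> vert G o ->
  finite_set (vert (gball G o s)).
Proof.
move=> degG Go; elim: s => [|s IH].
  by apply: (sub_finite_set _ (finite_set1 o)) => x [_ /within0 ->].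
apply: (@sub_finite_set _ _ (vert (gball G o s) `|`
    \bigcup_(z in vert (gball G o s)) nbr G z)).
  move=> x [Gx /withinS[xs|[z zs zx]]]; first by left.
  by right; exists z => //; split => //; exact: adj_vert zx.
rewrite finite_setU; split => //; apply: bigcup_finite => // z [Gz _].
exact: card_le_finite (degG _ Gz) (finite_II _).
Qed.

Lemma ultra_finite (U : set_system nat) (h : nat -> nat) (s : seq nat) :
  UltraFilter U -> U [set n | h n \in s] -> exists y, U [set n | h n = y].
Proof.
move=> UU; elim: s => [|y s IH] hs.
  by exfalso; apply: (@filter_not_empty _ U _); apply: filterS hs.
have [hy|hy] := in_ultra_setVsetC [set n | h n = y] UU; first by exists y.
apply: IH; apply: filterS (filterI hs hy) => n [/=].
by rewrite in_cons => /orP[/eqP|].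
Qed.

(* If the balls of every radius are isomorphic, then so are the graphs; the
   isomorphism is an ultrafilter limit of isomorphisms of balls. *)
Lemma konig Delta (G H : graph) o p (f_ : nat -> nat -> nat) :
    vert G o -> vert H p -> connected_graph G -> connected_graph H ->
    degree_le Delta G -> degree_le Delta H ->
    (forall n, (0 < n)%N ->
       graph_iso (f_ n) (gball G o n) (gball H p n) /\ f_ n o = p) ->
  exists f, graph_iso f G H /\
    forall x, vert G x -> exists2 n, (0 < n)%N & f x = f_ n x.
Proof.
move=> Go Hp cG cH dG dH fP.
have [U [UU subU]] := @ultraFilterLemma nat \oo _.
have Uge m : U [set n | (m < n)%N] by apply: subU; exists m.+1.
have fV n s x : (s <= n)%N -> (0 < n)%N -> vert (gball G o s) x ->
    vert (gball H p s) (f_ n x).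
  move=> sn n0 Bx; have [fi fo] := fP _ n0.
  have [[fB _ _] _] := gball_iso_le Go sn fi fo.
  exact: fB.
have lim x : exists y, vert G x -> U [set n | f_ n x = y].
  have [Gx|nGx] := pselect (vert G x); last by exists 0%N.
  have [s xs] := cG _ _ Go Gx.
  have [B BE] := (finite_seqP _).1 (gball_finite s dH Hp).
  have [y Uy] : exists y, U [set n | f_ n x = y].
    apply: (@ultra_finite U (fun n => f_ n x) B).
    apply: filterS (Uge s) => n /= sn.
    suff : vert (gball H p s) (f_ n x) by rewrite BE.
    by apply: fV; [exact: ltnW|exact: leq_ltn_trans sn|split].
  by exists y.
have [f fU] := choice lim.
exists f; split; last first.
  move=> x Gx.
  have [n [fn n0]] := filter_ex (filterI (fU _ Gx) (Uge 0%N)).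
  by exists n.
have cmp x y : vert G x -> vert G y -> exists n, [/\ (0 < n)%N,
    vert (gball G o n) x, vert (gball G o n) y, f_ n x = f x & f_ n y = f y].
  move=> Gx Gy; have [s xs] := cG _ _ Go Gx; have [t yt] := cG _ _ Go Gy.
  have [n [[fx fy] [sn tn]]] :=
    filter_ex (filterI (filterI (fU _ Gx) (fU _ Gy)) (filterI (Uge s) (Uge t))).
  exists n; split => //; first exact: leq_ltn_trans sn.
  - by split => //; exact: within_le (ltnW sn) xs.
  - by split => //; exact: within_le (ltnW tn) yt.
split.
  split.
  - move=> x Gx; have [n [n0 Bx _ <- _]] := cmp _ _ Gx Gx.
    by have [] := fV n n x (leqnn n) n0 Bx.
  - move=> x y; rewrite !inE => Gx Gy.
    have [n [n0 Bx By <- <-]] := cmp _ _ Gx Gy.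
    by have [[[_ finj _] _] _] := fP _ n0; apply: finj; rewrite inE.
  - move=> y Hy; have [s ys] := cH _ _ Hp Hy.
    have /choice[h hP] : forall n, exists x, (s < n)%N ->
        vert (gball G o s) x /\ f_ n x = y.
      move=> n; have [sn|sn] := ltnP s n; last by exists 0%N.
      have n0 : (0 < n)%N by exact: leq_ltn_trans sn.
      have [fi fo] := fP _ n0.
      have [[_ _ fsurj] _] := gball_iso_le Go (ltnW sn) fi fo.
      by have [//|x Bx fx] := fsurj y; exists x.
    have [B BE] := (finite_seqP _).1 (gball_finite s dG Go).
    have [x Ux] : exists x, U [set n | h n = x].
      apply: (@ultra_finite U h B); apply: filterS (Uge s) => n /= /hP[Bh _].
      by move: Bh; rewrite BE.
    have Gx : vert G x.
      by have [n [<- /hP[[]]]] := filter_ex (filterI Ux (Uge s)).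
    exists x => //.
    have [n [[<- hx] /hP[_ hn]]] :=
      filter_ex (filterI (filterI (fU _ Gx) Ux) (Uge s)).
    by rewrite -hx.
move=> x y Gx Gy; have [n [n0 Bx By <- <-]] := cmp _ _ Gx Gy.
have [[[fB _ _] fa] fo] := fP _ n0.
rewrite -(@adj_gball H p n) ?fa ?adj_gball//.
- exact: fB.
- exact: fB.
Qed.

(** * The classes [G,o] and [G,o1,o2] *)

Lemma rooted_iso_equiv Delta : equiv_class_of (@rooted_iso Delta).
Proof.
split.
- by move=> G; apply/asboolP; exact: iso1_refl.
- move=> G H; apply/asboolP/asboolP; apply: iso1_sym; exact: root_vert.
- by move=> H G K /asboolP GH /asboolP HK; apply/asboolP; exact: iso1_trans HK.
Qed.

Canonical rooted_iso_equiv_rel Delta :=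
  EquivRelPack (@rooted_iso_equiv Delta).

Lemma root1_vert Delta (G : birooted Delta) : vert G (root1 G).
Proof. exact: adj_vert (root_adj G). Qed.

Lemma root2_vert Delta (G : birooted Delta) : vert G (root2 G).
Proof. exact: adj_vertr (root_adj G). Qed.

Lemma birooted_iso_equiv Delta : equiv_class_of (@birooted_iso Delta).
Proof.
split.
- by move=> G; apply/asboolP; exact: iso2_refl.
- move=> G H; apply/asboolP/asboolP; apply: iso2_sym;
    by [exact: root1_vert|exact: root2_vert].
- by move=> H G K /asboolP GH /asboolP HK; apply/asboolP; exact: iso2_trans HK.
Qed.

Canonical birooted_iso_equiv_rel Delta :=
  EquivRelPack (@birooted_iso_equiv Delta).

(* The parameter R does not affect the points of the spaces; it is the field in
   which their distances take values. *)
Definition Gr (R : realType) (Delta : nat) : Type :=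
  {eq_quot @rooted_iso Delta}.

(* Positivity of Delta makes this space nonempty, which the library requires
   of a measurable space. *)
Definition vecGr (R : realType) (Delta : nat) (Delta_gt0 : (0 < Delta)%N) :
    Type :=
  {eq_quot @birooted_iso Delta}.

HB.instance Definition _ R Delta := Choice.on (Gr R Delta).
HB.instance Definition _ R Delta (Delta_gt0 : (0 < Delta)%N) :=
  Choice.on (vecGr R Delta_gt0).

Definition class1 R Delta (G : rooted Delta) : Gr R Delta :=
  \pi_{eq_quot @rooted_iso Delta} G.

Definition repr1 R Delta (c : Gr R Delta) : rooted Delta :=
  repr (c : {eq_quot @rooted_iso Delta}).

Definition class2 R Delta (Delta_gt0 : (0 < Delta)%N) (G : birooted Delta) :
    vecGr R Delta_gt0 :=
  \pi_{eq_quot @birooted_iso Delta} G.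

Definition repr2 R Delta (Delta_gt0 : (0 < Delta)%N) (c : vecGr R Delta_gt0) :
    birooted Delta :=
  repr (c : {eq_quot @birooted_iso Delta}).

Lemma repr1K R Delta : cancel (@repr1 R Delta) (@class1 R Delta).
Proof. by move=> c; exact: reprK. Qed.

Lemma repr2K R Delta (Delta_gt0 : (0 < Delta)%N) :
  cancel (@repr2 R Delta Delta_gt0) (@class2 R Delta Delta_gt0).
Proof. by move=> c; exact: reprK. Qed.

Lemma class1P R Delta (G H : rooted Delta) :
  class1 R G = class1 R H <-> iso1 G (root G) H (root H).
Proof.
split=> [e|e]; first by apply/asboolP/(@eqmodP _ (rooted_iso_equiv_rel Delta)).
by apply/(@eqmodP _ (rooted_iso_equiv_rel Delta))/asboolP.
Qed.

Lemma class2P R Delta (Delta_gt0 : (0 < Delta)%N) (G H : birooted Delta) :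
  class2 R Delta_gt0 G = class2 R Delta_gt0 H <->
  iso2 G (root1 G) (root2 G) H (root1 H) (root2 H).
Proof.
split=> [e|e]; first by apply/asboolP/(@eqmodP _ (birooted_iso_equiv_rel Delta)).
by apply/(@eqmodP _ (birooted_iso_equiv_rel Delta))/asboolP.
Qed.

(** * The metrics *)

(* The library's [sup] of an unbounded set is 0; by [konig], the sets
   [agree1 c1 c2] and [agree2 c1 c2] below are bounded whenever [c1 <> c2]. *)
Definition agree_dist (R : realType) (T : eqType) (agree : T -> T -> set nat)
    (c1 c2 : T) : R :=
  if c1 == c2 then 0 else 2 `^ (- sup [set (s%:R : R) | s in agree c1 c2]).

Definition agree1 R Delta (c1 c2 : Gr R Delta) : set nat :=
  let G := repr1 c1 in let H := repr1 c2 in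
  [set s | iso1 (gball G (root G) s) (root G) (gball H (root H) s) (root H)].

Definition agree2 R Delta (Delta_gt0 : (0 < Delta)%N)
    (c1 c2 : vecGr R Delta_gt0) : set nat :=
  let G := repr2 c1 in let H := repr2 c2 in
  [set s | s = 0%N \/
     iso2 (gball G (root1 G) s) (root1 G) (root2 G)
          (gball H (root1 H) s) (root1 H) (root2 H)].

Section agree_dist_theory.
Context (R : realType) (T : eqType) (agree : T -> T -> set nat).
Context (agree0 : forall x y, agree x y 0%N).
Context (agree_le : forall x y m n, (m <= n)%N -> agree x y n -> agree x y m).
Context (agree_sym : forall x y n, agree x y n -> agree y x n).
Context (agree_trans : forall y x z n,
  agree x y n -> agree y z n -> agree x z n).
Context (agree_sep : forall x y, (forall n, agree x y n) -> x = y).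

Let d := @agree_dist R T agree.

Lemma agree_distxx x : d x x = 0.
Proof. by rewrite /d /agree_dist eqxx. Qed.

Lemma agree_dist_positivity x y : d x y = 0 -> x = y.
Proof.
rewrite /d /agree_dist; case: eqP => // _ /powR_eq0_eq0/eqP.
by rewrite pnatr_eq0.
Qed.

Lemma agree_dist_sym x y : d x y = d y x.
Proof.
rewrite /d /agree_dist eq_sym.
have -> // : agree x y = agree y x by apply/seteqP; split=> n; exact: agree_sym.
Qed.

Lemma agree_dist_eq x y : x != y ->
  exists n, [/\ agree x y n, forall m, agree x y m -> (m <= n)%N
            & d x y = 2 `^ (- n%:R)].
Proof.
move=> xy; have [N nN] : exists N, ~ agree x y N.
  apply: contrapT => /forallNP h; move/eqP: xy; apply; apply: agree_sep => n.
  exact: contrapT (h n).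
have ex : exists n, `[< agree x y n >] by exists 0%N; apply/asboolP.
have ub n : `[< agree x y n >] -> (n <= N)%N.
  move=> /asboolP an; rewrite leqNgt; apply/negP => /ltnW Nn.
  exact/nN/(agree_le Nn).
have [n /asboolP an maxn] := ex_maxnP ex ub.
have {}maxn m : agree x y m -> (m <= n)%N by move=> am; exact/maxn/asboolP.
exists n; split => //; rewrite /d /agree_dist (negbTE xy); do 2 f_equal.
have ubn : ubound [set (s%:R : R) | s in agree x y] n%:R.
  by move=> _ [m /maxn mn <-]; rewrite ler_nat.
apply/eqP; rewrite eq_le; apply/andP; split.
  by apply: ge_sup => //; exists n%:R; exists n.
by apply: ub_le_sup; [exists n%:R|exists n].
Qed.

Lemma agree_dist_ultra y x z : d x z <= Num.max (d x y) (d y z).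
Proof.
have [->|xy] := eqVneq x y; first by rewrite le_max lexx orbT.
have [->|yz] := eqVneq y z; first by rewrite le_max lexx.
have [->|xz] := eqVneq x z.
  by rewrite agree_distxx le_max /d /agree_dist; case: eqP; rewrite ?lexx// powR_ge0.
have [a [xya _ ->]] := agree_dist_eq xy.
have [b [yzb _ ->]] := agree_dist_eq yz.
have [c [_ maxc ->]] := agree_dist_eq xz.
have abc : (minn a b <= c)%N.
  apply/maxc/(@agree_trans y).
  - exact: agree_le (geq_minl _ _) xya.
  - exact: agree_le (geq_minr _ _) yzb.
move: abc; rewrite geq_min le_max => /orP[ac|bc]; apply/orP; [left|right];
  by apply: ler_powR; rewrite ?ler1n// lerN2 ler_nat.
Qed.

Lemma agree_dist_triangle y x z : d x z <= d x y + d y z.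
Proof.
have d0 u v : 0 <= d u v by rewrite /d /agree_dist; case: eqP; rewrite ?powR_ge0.
by rewrite (le_trans (agree_dist_ultra y _ _))// ge_max lerDl lerDr !d0.
Qed.

End agree_dist_theory.

Section Gr_metric.
Context (R : realType) (Delta : nat).
Implicit Types x y z : Gr R Delta.

Let agree0 x y : agree1 x y 0%N.
Proof.
have H (G : rooted Delta) : vert (gball G (root G) 0) = [set root G].
  apply/seteqP; split=> [u [_ /within0]//|_ ->].
  by apply: gball_root; exact: root_vert.
exists (fun=> root (repr1 y)); split => //; split.
  split; rewrite ?H.
  - by [].
  - by move=> u v; rewrite !inE /= => -> ->.
  - by move=> _ /= ->; exists (root (repr1 x)).
by move=> u v; rewrite H /= => -> ->; rewrite !adj_irr.
Qed.

Let agree_le x y m n : (m <= n)%N -> agree1 x y n -> agree1 x y m.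
Proof.
move=> mn [f [fi fo]]; exists f; split => //.
exact: gball_iso_le (root_vert _) mn fi fo.
Qed.

Let agree_sym x y n : agree1 x y n -> agree1 y x n.
Proof. by apply: iso1_sym; apply: gball_root; exact: root_vert. Qed.

Let agree_trans y x z n : agree1 x y n -> agree1 y z n -> agree1 x z n.
Proof. exact: iso1_trans. Qed.

Let agree_sep x y : (forall n, agree1 x y n) -> x = y.
Proof.
move=> /choice[f_ fP]; rewrite -(repr1K x) -(repr1K y); apply/class1P.
have [f [fi fE]] := konig (root_vert _) (root_vert _) (rooted_connected _)
  (rooted_connected _) (rooted_degree _) (rooted_degree _) (fun n _ => fP n).
exists f; split => //.
by have [n _ ->] := fE _ (root_vert _); have [] := fP n.
Qed.

HB.instance Definition _ := isMetric.Build R (Gr R Delta)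
  (@agree_distxx R _ (@agree1 R Delta))
  (@agree_dist_positivity R _ (@agree1 R Delta))
  (agree_dist_sym R agree_sym)
  (agree_dist_triangle R agree0 agree_le agree_trans agree_sep).

End Gr_metric.

Section vecGr_metric.
Context (R : realType) (Delta : nat) (Delta_gt0 : (0 < Delta)%N).
Implicit Types x y z : vecGr R Delta_gt0.

Let agree0 x y : agree2 x y 0%N. Proof. by left. Qed.

Let agree_le x y m n : (m <= n)%N -> agree2 x y n -> agree2 x y m.
Proof.
move=> mn [n0|[f [fi fo fo2]]]; first by left; apply/eqP; rewrite -leqn0 -n0.
by right; exists f; split => //; exact: gball_iso_le (root1_vert _) mn fi fo.
Qed.

Let agree_sym x y n : agree2 x y n -> agree2 y x n.
Proof.
case: n => [|n]; first by left.
move=> [//|xy]; right; apply: iso2_sym xy.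
  by apply: gball_root; exact: root1_vert.
by apply: gball_nbr => //; exact: root_adj.
Qed.

Let agree_trans y x z n : agree2 x y n -> agree2 y z n -> agree2 x z n.
Proof.
move=> [->|xy]; first by left.
by move=> [->|yz]; [left|right; exact: iso2_trans xy yz].
Qed.

Let agree_sep x y : (forall n, agree2 x y n) -> x = y.
Proof.
move=> xy; rewrite -(repr2K x) -(repr2K y); apply/class2P.
have /choice[f_ fP] : forall n, exists f, (0 < n)%N ->
    [/\ graph_iso f (gball (repr2 x) (root1 (repr2 x)) n)
                    (gball (repr2 y) (root1 (repr2 y)) n),
        f (root1 (repr2 x)) = root1 (repr2 y)
      & f (root2 (repr2 x)) = root2 (repr2 y)].
  by move=> [|n]; [exists id|have [//|[f ?]] := xy n.+1; exists f].
have [f [fi fE]] := konig (root1_vert _) (root1_vert _)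
  (birooted_connected _) (birooted_connected _)
  (birooted_degree _) (birooted_degree _)
  (fun n n0 => let: And3 fi fo _ := fP n n0 in conj fi fo).
exists f; split => //.
- by have [n /fP[_ fo _] ->] := fE _ (root1_vert _).
- by have [n /fP[_ _ fo] ->] := fE _ (root2_vert _).
Qed.

HB.instance Definition _ := isMetric.Build R (vecGr R Delta_gt0)
  (@agree_distxx R _ (@agree2 R Delta Delta_gt0))
  (@agree_dist_positivity R _ (@agree2 R Delta Delta_gt0))
  (agree_dist_sym R agree_sym)
  (agree_dist_triangle R agree0 agree_le agree_trans agree_sep).

End vecGr_metric.

(** * The Borel structures *)

Section Gr_point.
Context (Delta : nat).

Definition graph1 : graph :=
  @Graph [set 0%N] [rel x y | false] (fun _ _ => erefl) (fun _ => erefl)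
    (fun _ _ => fun h : false => False_ind _ (notF h)).

Let conn1 : connected_graph graph1.
Proof. by move=> x y /= -> ->; exists 0%N; exact: within_refl. Qed.

Let deg1 : degree_le Delta graph1.
Proof.
move=> x _; have -> : nbr graph1 x = set0 by apply/seteqP; split.
exact: card_ge0.
Qed.

Definition rooted1 : rooted Delta := @Rooted Delta graph1 0%N erefl conn1 deg1.

Let adj2 : rel nat := [rel x y | x + y == 1]%N.
Let adj2_sym : symmetric adj2. Proof. by move=> x y; rewrite /adj2 /= addnC. Qed.
Let adj2_irr : irreflexive adj2. Proof. by case=> [//|x]; rewrite /adj2 /= addnS. Qed.
Let adj2_vert x y : adj2 x y -> [set z | z < 2]%N x.
Proof. by move=> /eqP <-; rewrite /= ltnS leq_addr. Qed.

Definition graph2 : graph := Graph adj2_sym adj2_irr adj2_vert.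

Let conn2 : connected_graph graph2.
Proof.
move=> [|[|//]] [|[|//]] _ _; exists 1%N; do 1?exact: within_refl.
- by exists [:: 1%N].
- by exists [:: 0%N].
Qed.

Let deg2 : (0 < Delta)%N -> degree_le Delta graph2.
Proof.
move=> D0 x _; apply: (@card_le_trans _ _ _ [set (1 - x)%N]).
  by apply: subset_card_le => y /= /eqP <-; rewrite addKn.
rewrite (card_le_eql card_set1).
by apply: subset_card_le => i /= i1; exact: leq_trans D0.
Qed.

Definition birooted2 (D0 : (0 < Delta)%N) : birooted Delta :=
  @Birooted Delta graph2 0%N 1%N erefl conn2 (deg2 D0).

End Gr_point.

HB.instance Definition _ R Delta :=
  isPointed.Build (Gr R Delta) (class1 R (rooted1 Delta)).

HB.instance Definition _ R Delta (Delta_gt0 : (0 < Delta)%N) :=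
  isPointed.Build (vecGr R Delta_gt0) (class2 R Delta_gt0 (birooted2 Delta_gt0)).

HB.instance Definition _ R Delta :=
  Measurable.copy (Gr R Delta) (g_sigma_algebraType (@open (Gr R Delta))).

HB.instance Definition _ R Delta (Delta_gt0 : (0 < Delta)%N) :=
  Measurable.copy (vecGr R Delta_gt0)
    (g_sigma_algebraType (@open (vecGr R Delta_gt0))).

(** * Unimodularity and weak convergence *)

Section reroot.
Context (Delta : nat) (G : rooted Delta) (x : {x | adj G (root G) x}).

Definition outgoing : birooted Delta :=
  Birooted (svalP x) (rooted_connected G) (rooted_degree G).

Let root_adj_sym : adj G (sval x) (root G).
Proof. by rewrite adj_sym (svalP x). Qed.

Definition incoming : birooted Delta :=
  Birooted root_adj_sym (rooted_connected G) (rooted_degree G).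

End reroot.

Section sums.
Context (R : realType) (Delta : nat) (Delta_gt0 : (0 < Delta)%N).
Context (f : vecGr R Delta_gt0 -> R).

Definition out_sum_of (G : rooted Delta) : R :=
  \sum_(x \in [set: {x | adj G (root G) x}]) f (class2 R Delta_gt0 (outgoing x)).

Definition in_sum_of (G : rooted Delta) : R :=
  \sum_(x \in [set: {x | adj G (root G) x}]) f (class2 R Delta_gt0 (incoming x)).

Definition out_sum (c : Gr R Delta) : R := out_sum_of (repr1 c).

Definition in_sum (c : Gr R Delta) : R := in_sum_of (repr1 c).

Lemma iso1_nbr (G H : rooted Delta) : iso1 G (root G) H (root H) ->
  exists h : {x | adj G (root G) x} -> {x | adj H (root H) x},
  [/\ bijective h,
   forall x, class2 R Delta_gt0 (outgoing (h x)) = class2 R Delta_gt0 (outgoing x)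
 & forall x, class2 R Delta_gt0 (incoming (h x)) = class2 R Delta_gt0 (incoming x)].
Proof.
move=> [f0 [fi fo]]; have [g [gi gf fg]] := graph_iso_inv fi.
have go : g (root H) = root G by rewrite -fo gf//; exact: root_vert.
have fadj x : adj G (root G) x -> adj H (root H) (f0 x).
  move=> Gx; rewrite -fo; case: fi => _ -> //; first exact: root_vert.
  exact: adj_vertr Gx.
have gadj x : adj H (root H) x -> adj G (root G) (g x).
  move=> Hx; rewrite -go; case: gi => _ -> //; first exact: root_vert.
  exact: adj_vertr Hx.
exists (fun x => exist _ (f0 (sval x)) (fadj _ (svalP x))); split.
- exists (fun y => exist _ (g (sval y)) (gadj _ (svalP y))).
  + by move=> [x Gx]; apply: val_inj => /=; apply: gf; exact: adj_vertr Gx.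
  + by move=> [y Hy]; apply: val_inj => /=; apply: fg; exact: adj_vertr Hy.
- move=> [x Gx]; apply/class2P; exists g; split => //=.
  by apply: gf; exact: adj_vertr Gx.
- move=> [x Gx]; apply/class2P; exists g; split => //=.
  by apply: gf; exact: adj_vertr Gx.
Qed.

(* [out_sum] and [in_sum] do not depend on the representative chosen by [repr1]. *)
Lemma out_sumE (G : rooted Delta) : out_sum (class1 R G) = out_sum_of G.
Proof.
have /class1P/iso1_nbr[h [hb hE _]] := repr1K (class1 R G).
rewrite /out_sum /out_sum_of [RHS](reindex_fsbigT h)//.
by apply: eq_fsbigr => x _; rewrite hE.
Qed.

Lemma in_sumE (G : rooted Delta) : in_sum (class1 R G) = in_sum_of G.
Proof.
have /class1P/iso1_nbr[h [hb _ hE]] := repr1K (class1 R G).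
rewrite /in_sum /in_sum_of [RHS](reindex_fsbigT h)//.
by apply: eq_fsbigr => x _; rewrite hE.
Qed.

End sums.

Definition unimodular (R : realType) (Delta : nat) (Delta_gt0 : (0 < Delta)%N)
    (mu : probability (Gr R Delta) R) : Prop :=
  forall f : vecGr R Delta_gt0 -> R,
    measurable_fun [set: vecGr R Delta_gt0] f -> (forall c, 0 <= f c) ->
    (\int[mu]_c (in_sum f c)%:E = \int[mu]_c (out_sum f c)%:E)%E.

Definition weak_cvg (R : realType) (Delta : nat)
    (mu_ : nat -> probability (Gr R Delta) R) (mu : probability (Gr R Delta) R) :
    Prop :=
  forall f : Gr R Delta -> R, continuous f ->
    (fun n => \int[mu_ n]_c (f c)%:E)%E @ \oo --> (\int[mu]_c (f c)%:E)%E.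

(* Main.v *)
Require Import Defs.
From mathcomp Require Import all_boot all_order all_algebra finmap.
From mathcomp Require Import all_classical all_reals all_analysis.
From mathcomp Require Import measurable_realfun.
(* Restores the [within] of graph distances, hidden by the filter [within]. *)
Import Defs.

Set Implicit Arguments.
Unset Strict Implicit.
Unset Printing Implicit Defensive.

Import Order.TTheory GRing.Theory Num.Theory.
Import numFieldNormedType.Exports HBNNSimple.

Local Open Scope classical_set_scope.
Local Open Scope ring_scope.

(** For a test function [f] on birooted graphs, [in_sum f] and [out_sum f] at a
    rooted graph are sums of [f] over at most [Delta] birooted graphs, one for
    each neighbour of the root.  If [f] depends only on the ball of radius [n]
    around the first root, then both sums depend only on the ball of radius
    [n + 1] around the root: an isomorphism of two such balls matches the
    neighbours of the roots, and it restricts to an isomorphism of the balls of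
    radius [n] around any matched pair of neighbours ([agree_neighbours]).  Such
    sums are locally constant, hence continuous, and mass transport for [f]
    passes to the weak limit ([balanced_finite_range]).

    It remains to reach every Borel [f >= 0], for a fixed measure [mu].  Let
    [U] be open and let [U_ n] be the set of those [c] such that [U] contains
    every class with the same ball of radius [n] as [c].  The [U_ n] increase to
    [U], and the indicator of [U_ n] depends only on the ball of radius [n], so
    monotone convergence gives the identity for the indicator of [U]
    ([balanced_open]).  The open sets form a pi-system that generates the Borel
    sets.  Because the number of summands is bounded, the
    identity passes to complements, so Dynkin's theorem gives it for indicators
    of all Borel sets; sums and monotone limits then give it for all
    nonnegative Borel functions ([balanced_measurable]). *)

(** * Mass transport as an identity between two integrals *)

Section balanced.
Context d d' (T : measurableType d) (Y : measurableType d') (R : realType).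
Context (mu : probability T R) (P Q : T -> seq Y).
Local Open Scope ereal_scope.

Definition seq_sum (S : T -> seq Y) (f : Y -> \bar R) (t : T) : \bar R :=
  \sum_(y <- S t) f y.

(** [P t] and [Q t] list finitely many points of [Y] attached to [t], with
    multiplicity: below, the incoming and the outgoing edges at a root.  The two
    measurability clauses belong to the definition because they are proved by
    the same induction on [f] as the equality of the integrals. *)
Definition balanced (f : Y -> \bar R) : Prop :=
  [/\ measurable_fun setT (seq_sum P f), measurable_fun setT (seq_sum Q f)
    & \int[mu]_t seq_sum P f t = \int[mu]_t seq_sum Q f t].

Lemma seq_sum_ge0 S f : (forall y, 0 <= f y) -> forall t, 0 <= seq_sum S f t.
Proof. by move=> f0 t; apply: sume_ge0. Qed.

Lemma balancedD f g : (forall y, 0 <= f y) -> (forall y, 0 <= g y) ->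
  balanced f -> balanced g -> balanced (fun y => f y + g y).
Proof.
move=> f0 g0 [mPf mQf ef] [mPg mQg eg].
have D S : seq_sum S (fun y => f y + g y) =
    (fun t => seq_sum S f t + seq_sum S g t).
  by apply/funext => t; rewrite /seq_sum big_split.
split; rewrite ?D; [exact: emeasurable_funD|exact: emeasurable_funD|].
by rewrite !ge0_integralD// ?ef ?eg// => t _; exact: seq_sum_ge0.
Qed.

Lemma balancedZ (k : R) f : (0 <= k)%R -> (forall y, 0 <= f y) ->
  balanced f -> balanced (fun y => k%:E * f y).
Proof.
move=> k0 f0 [mPf mQf ef].
have D S : seq_sum S (fun y => k%:E * f y) = (fun t => k%:E * seq_sum S f t).
  by apply/funext => t; rewrite /seq_sum ge0_sume_distrr.
split; rewrite ?D; [exact: measurable_funeM|exact: measurable_funeM|].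
by rewrite !ge0_integralZl// ?ef// => t _; exact: seq_sum_ge0.
Qed.

Lemma balanced_sum (I : eqType) (s : seq I) (F : I -> Y -> \bar R) :
  (forall i, i \in s -> (forall y, 0 <= F i y) /\ balanced (F i)) ->
  balanced (fun y => \sum_(i <- s) F i y).
Proof.
elim: s => [|i s IH] bF.
  have E S : seq_sum S (fun y => \sum_(i <- [::]) F i y) = cst 0.
    by apply/funext => t; rewrite /seq_sum big1// => y _; rewrite big_nil.
  by split; rewrite ?E.
have -> : (fun y => \sum_(j <- i :: s) F j y) =
    (fun y => F i y + \sum_(j <- s) F j y).
  by apply/funext => y; rewrite big_cons.
have [Fi0 bFi] := bF i (mem_head _ _).
have bs j : j \in s -> (forall y, 0 <= F j y) /\ balanced (F j).
  by move=> js; apply: bF; rewrite in_cons js orbT.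
apply: balancedD => //; last exact: IH.
by move=> y; rewrite big_seq; apply: sume_ge0 => j /bs[].
Qed.

(** Monotone convergence; the limit passes through the sums because they are
    finite and their terms are nonnegative. *)
Lemma balanced_lim (f_ : nat -> Y -> \bar R) f :
    (forall n y, 0 <= f_ n y) ->
    (forall y, {homo f_ ^~ y : m n / (m <= n)%N >-> m <= n}) ->
    (forall y, f_ n y @[n --> \oo] --> f y) ->
    (forall n, balanced (f_ n)) -> balanced f.
Proof.
move=> f0 nd cf bf.
have nd' S t : {homo (fun n => seq_sum S (f_ n) t) : m n / (m <= n)%N >-> m <= n}.
  by move=> m n mn; apply: lee_sum => y _; exact: nd.
have cS S t : seq_sum S (f_ n) t @[n --> \oo] --> seq_sum S f t.
  rewrite /seq_sum; elim: (S t) => [|y s IH].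
    by rewrite big_nil; under eq_fun do rewrite big_nil; exact: cvg_cst.
  rewrite big_cons; under eq_fun do rewrite big_cons.
  apply: cvgeD => //.
  have f0' z : 0 <= f z.
    rewrite -(cvg_lim _ (cf z))//.
    by apply: lime_ge; [apply/cvg_ex; exists (f z)|exact: nearW].
  by apply: ge0_adde_def; rewrite inE ?sume_ge0.
have mS S : (forall n, measurable_fun setT (seq_sum S (f_ n))) ->
    measurable_fun setT (seq_sum S f).
  move=> mS; apply: emeasurable_fun_cvg => //; [exact: mS|move=> t _; exact: cS].
have iS S : (forall n, measurable_fun setT (seq_sum S (f_ n))) ->
    \int[mu]_t seq_sum S (f_ n) t @[n --> \oo] --> \int[mu]_t seq_sum S f t.
  move=> mSn.
  rewrite [X in _ --> X](_ : _ = \int[mu]_t limn (fun n => seq_sum S (f_ n) t)).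
    apply: cvg_monotone_convergence => // n t _.
    exact: seq_sum_ge0.
  by apply: eq_integral => t _; rewrite (cvg_lim _ (cS S t)).
have mP n : measurable_fun setT (seq_sum P (f_ n)) by have [] := bf n.
have mQ n : measurable_fun setT (seq_sum Q (f_ n)) by have [] := bf n.
split; [exact: mS|exact: mS|].
have /cvg_lim <- // := iS P mP; have /cvg_lim <- // := iS Q mQ.
by congr (limn _); apply/funext => n; have [] := bf n.
Qed.

(** The integral over [setT] is the sum of the integrals over [A] and over its
    complement.  The bound [N] on the number of points makes the integral over
    [A] finite, so that it can be cancelled. *)
Lemma balanced_indicC N A :
  (forall t, (size (P t) <= N)%N) -> (forall t, (size (Q t) <= N)%N) ->
  balanced (fun y => (\1_A y)%:E) -> balanced (cst 1) ->
  balanced (fun y => (\1_(~` A) y)%:E).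
Proof.
move=> sP sQ [mPA mQA eA] [mP1 mQ1 e1].
have DE S t : seq_sum S (cst 1) t =
    seq_sum S (fun y => (\1_A y)%:E) t + seq_sum S (fun y => (\1_(~` A) y)%:E) t.
  rewrite /seq_sum -big_split; apply: eq_bigr => y _ /=.
  by rewrite -EFinD !indicE in_setC; case: (y \in A); rewrite /= ?addr0 ?add0r.
have fS S B t : seq_sum S (fun y => (\1_B y)%:E) t \is a fin_num.
  by rewrite /seq_sum sumEFin.
have CE S : seq_sum S (fun y => (\1_(~` A) y)%:E) =
    (fun t => seq_sum S (cst 1) t - seq_sum S (fun y => (\1_A y)%:E) t).
  by apply/funext => t; rewrite DE addeAC subee ?add0e.
have mPC : measurable_fun setT (seq_sum P (fun y => (\1_(~` A) y)%:E)).
  by rewrite CE; exact: emeasurable_funB.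
have mQC : measurable_fun setT (seq_sum Q (fun y => (\1_(~` A) y)%:E)).
  by rewrite CE; exact: emeasurable_funB.
have i0 S B t : 0 <= seq_sum S (fun y => (\1_B y)%:E) t.
  by apply: seq_sum_ge0 => y; rewrite lee_fin.
have fin : \int[mu]_t seq_sum P (fun y => (\1_A y)%:E) t \is a fin_num.
  rewrite ge0_fin_numE; last exact: integral_ge0.
  apply: (@le_lt_trans _ _ (\int[mu]_t (cst N%:R%:E) t)); last first.
    rewrite integral_cst// [X in _ * X](_ : _ = 1) ?mule1 ?ltry//.
    exact: probability_setT.
  apply: ge0_le_integral => //.
  move=> t _; apply: (@le_trans _ _ (size (P t))%:R%:E).
    rewrite /seq_sum sumEFin lee_fin -sum1_size natr_sum; apply: ler_sum => y _.
    by rewrite indicE lern1 leq_b1.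
  by rewrite lee_fin ler_nat.
split => //.
set a := (X in X \is a fin_num) in fin.
move: e1; rewrite (eq_integral _ _ (fun t _ => DE P t)).
rewrite (eq_integral _ _ (fun t _ => DE Q t)).
rewrite !ge0_integralD// -eA -/a.
rewrite addeC [RHS]addeC => /(congr1 (fun z => z - a)) /=.
by rewrite !(addeK _ fin).
Qed.

(** Dynkin's theorem extends [balanced] from indicators of a generating
    pi-system to indicators of measurable sets; simple functions are sums of
    multiples of these, and nonnegative measurable functions are increasing
    limits of simple functions. *)
Lemma balanced_measurable N (G : set (set Y)) :
    (forall t, (size (P t) <= N)%N) -> (forall t, (size (Q t) <= N)%N) ->
    @measurable _ Y = <<s G >> -> setI_closed G -> G setT ->
    (forall A, G A -> balanced (fun y => (\1_A y)%:E)) ->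
  forall f : Y -> \bar R, measurable_fun setT f -> (forall y, 0 <= f y) ->
    balanced f.
Proof.
move=> sP sQ YG GI GT bG.
have b1 : balanced (cst 1) by have := bG _ GT; rewrite indicT.
pose D := [set A | balanced (fun y => (\1_A y)%:E)].
have bA A : measurable A -> D A.
  rewrite YG; apply: (@dynkin_induction _ _ G D YG GI) => //.
  - exact: bG _ GT.
  - by move=> S _ bS; exact: balanced_indicC sP sQ bS b1.
  move=> F mF tF bF.
  apply: (@balanced_lim (fun n y => \sum_(0 <= i < n) (\1_(F i) y)%:E)).
  - by move=> n y; apply: sume_ge0 => i _; rewrite lee_fin.
  - by move=> y m n mn; apply: lee_sum_nneg_natr => // i _ _; rewrite lee_fin.
  - move=> y; rewrite indic_bigcup//.
    by apply: is_cvg_nneseries => n _ _; rewrite lee_fin.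
  - move=> n; apply: balanced_sum => i _.
    by split; [move=> y; rewrite lee_fin|exact: bF].
have bs (h : {nnsfun Y >-> R}) : balanced (EFin \o h).
  have -> : EFin \o h = (fun y => \sum_(r <- fset_set (range h))
      (r%:E * (\1_(h @^-1` [set r]) y)%:E)) :> (Y -> \bar R).
    by apply/funext => y /=; rewrite (fimfunE h) fsbig_finite//= -sumEFin.
  apply: balanced_sum => r; rewrite in_fset_set// inE => -[y _ <-].
  split; first by move=> z; rewrite -EFinM lee_fin mulr_ge0.
  by apply: balancedZ => //; exact: bA.
move=> f mf f0.
pose h := nnsfun_approx measurableT mf.
apply: (@balanced_lim (fun n => EFin \o h n)) => //.
- by move=> n y /=; rewrite lee_fin.
- by move=> y m n mn /=; rewrite lee_fin; exact/lefP/nd_nnsfun_approx.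
- by move=> y; apply: cvg_nnsfun_approx.
Qed.

End balanced.

(** * Balls inside isomorphic induced subgraphs *)

Lemma within_cons (G : graph) s x y z :
  adj G x y -> within G s y z -> within G s.+1 x z.
Proof. by move=> xy [p [yp pz ps]]; exists (y :: p); rewrite /= xy. Qed.

Lemma adj_induced (G : graph) (A : set nat) x y :
  A x -> A y -> adj (induced G A) x y = adj G x y.
Proof. by move=> /mem_set Ax /mem_set Ay; rewrite /= Ax Ay !andbT. Qed.

(** A path of length at most [n] from [x] stays in the ball of radius [n]
    around [x], hence inside [A], where [f] preserves adjacency. *)
Lemma within_induced_iso (G H : graph) (A B : set nat) f x n :
    graph_iso f (induced G A) (induced H B) -> vert G x ->
    within G n x `<=` A ->
  forall s y, (s <= n)%N -> within G s x y -> within H s (f x) (f y).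
Proof.
move=> [[fH _ _] fa] Gx xA; elim=> [|s IH] y sn.
  by move=> /within0 ->; exact: within_refl.
move=> /withinS[ys|[z zs zy]].
  by apply: (within_le (leqnSn s)); apply: IH => //; exact: ltnW.
apply: (within_step (IH _ (ltnW sn) zs)).
have Az : vert (induced G A) z.
  by split; [exact: adj_vert zy|exact/xA/(within_le (ltnW sn))].
have Ay : vert (induced G A) y.
  by split; [exact: adj_vertr zy|apply/xA/(within_le sn)/(within_step zs)].
have [_ Bz] := fH _ Az; have [_ By] := fH _ Ay.
by rewrite -(adj_induced H Bz By) fa// adj_induced//; [case: Az|case: Ay].
Qed.

(** An isomorphism of large balls may be recentred at any vertex whose smaller
    ball still lies inside.  Below, [A] and [B] are balls of radius [n + 1]
    around two roots, and [x] is a neighbour of the first root. *)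
Lemma gball_induced_iso (G H : graph) (A B : set nat) f x n :
    graph_iso f (induced G A) (induced H B) -> vert G x ->
    within G n x `<=` A -> within H n (f x) `<=` B ->
  graph_iso f (gball G x n) (gball H (f x) n).
Proof.
move=> fi Gx xA fxB; have [g [gi gf fg]] := graph_iso_inv fi.
have [[fH finj _] fa] := fi; have [[gG _ _] _] := gi.
have Ax : vert (induced G A) x by split => //; exact/xA/within_refl.
have Hfx : vert H (f x) by have [] := fH _ Ax.
have GA y : vert (gball G x n) y -> vert (induced G A) y.
  by move=> [Gy /xA].
have fB y : vert (gball G x n) y -> vert (gball H (f x) n) (f y).
  move=> By; split; first by have [] := fH _ (GA _ By).
  by apply: (within_induced_iso fi Gx xA (leqnn n)); case: By.
split.
  split; first exact: fB.
  - by move=> y z; rewrite !inE => By Bz; apply: finj; rewrite inE; exact: GA.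
  - move=> y [Hy fxy].
    have By : vert (induced H B) y by split => //; exact: fxB.
    exists (g y); last exact: fg.
    split; first by have [] := gG _ By.
    have := within_induced_iso gi Hfx fxB (leqnn n) fxy.
    by rewrite gf.
move=> y z By Bz; have [_ Hy] := fB _ By; have [_ Hz] := fB _ Bz.
have [Ay Az] := (GA _ By, GA _ Bz).
have [_ Bfy] := fH _ Ay; have [_ Bfz] := fH _ Az.
rewrite !adj_induced//; last 2 first.
- by case: By.
- by case: Bz.
by rewrite -(adj_induced H Bfy Bfz) fa// adj_induced//; [case: Ay|case: Az].
Qed.

Lemma graph_iso_gball (G H : graph) f x n : graph_iso f G H -> vert G x ->
  graph_iso f (gball G x n) (gball H (f x) n).
Proof.
move=> [[fH finj fsurj] fa] Gx.
have T K : vert (induced K setT) = vert K by rewrite /= setIT.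
apply: (@gball_induced_iso _ _ setT setT) => //.
split; first by rewrite !T; split.
by rewrite T => y z Gy Gz; rewrite !adj_induced// fa.
Qed.

(** * Agreement of balls and the metrics *)

Section agree_vecGr.
Context (R : realType) (Delta : nat) (Delta_gt0 : (0 < Delta)%N).
Implicit Types c : vecGr R Delta_gt0.

(** [agree2] is defined through chosen representatives of the classes; this is
    how it is established from arbitrary representatives. *)
Lemma agree2_of_iso (G H : birooted Delta) f n :
    graph_iso f (gball G (root1 G) n) (gball H (root1 H) n) ->
    f (root1 G) = root1 H -> f (root2 G) = root2 H ->
  agree2 (class2 R Delta_gt0 G) (class2 R Delta_gt0 H) n.
Proof.
case: n => [|n] fi f1 f2; first by left.
right.
have ball_repr (K : birooted Delta) :
    let L := repr2 (class2 R Delta_gt0 K) in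
    iso2 (gball L (root1 L) n.+1) (root1 L) (root2 L)
         (gball K (root1 K) n.+1) (root1 K) (root2 K).
  have /class2P[g [gi g1 g2]] := repr2K (class2 R Delta_gt0 K).
  exists g; split => //; rewrite -[X in gball K X]g1.
  exact: graph_iso_gball gi (root1_vert _).
have GH : iso2 (gball G (root1 G) n.+1) (root1 G) (root2 G)
    (gball H (root1 H) n.+1) (root1 H) (root2 H) by exists f.
apply: iso2_trans (ball_repr G) (iso2_trans GH _); apply: iso2_sym (ball_repr H).
  by apply: gball_root; exact: root1_vert.
by apply: gball_nbr => //; exact: root_adj.
Qed.

Lemma agree2_le c1 c2 m n : (m <= n)%N -> agree2 c1 c2 n -> agree2 c1 c2 m.
Proof.
move=> mn [n0|[f [fi f1 f2]]]; first by left; apply/eqP; rewrite -leqn0 -n0.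
by right; exists f; split => //; exact: gball_iso_le (root1_vert _) mn fi f1.
Qed.

Lemma agree2_sym c1 c2 n : agree2 c1 c2 n -> agree2 c2 c1 n.
Proof.
case: n => [|n]; first by left.
move=> [//|c12]; right; apply: iso2_sym c12.
  by apply: gball_root; exact: root1_vert.
by apply: gball_nbr => //; exact: root_adj.
Qed.

Lemma agree2_trans c1 c2 c3 n :
  agree2 c1 c2 n -> agree2 c2 c3 n -> agree2 c1 c3 n.
Proof.
move=> [->|c12]; first by left.
by move=> [->|c23]; [left|right; exact: iso2_trans c12 c23].
Qed.

(** The balls of every radius determine the class: [konig] assembles their
    isomorphisms into one of the whole graphs, which agrees at each vertex with
    one of them and therefore maps roots to roots. *)
Lemma agree2_sep c1 c2 : (forall n, agree2 c1 c2 n) -> c1 = c2.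
Proof.
move=> a12; rewrite -(repr2K c1) -(repr2K c2); apply/class2P.
have /choice[f_ fP] : forall n, exists f, (0 < n)%N ->
    [/\ graph_iso f (gball (repr2 c1) (root1 (repr2 c1)) n)
                    (gball (repr2 c2) (root1 (repr2 c2)) n),
        f (root1 (repr2 c1)) = root1 (repr2 c2)
      & f (root2 (repr2 c1)) = root2 (repr2 c2)].
  by move=> [|n]; [exists id|have [//|[f ?]] := a12 n.+1; exists f].
have [f [fi fE]] := konig (root1_vert _) (root1_vert _)
  (birooted_connected _) (birooted_connected _)
  (birooted_degree _) (birooted_degree _)
  (fun n n0 => let: And3 fi f1 _ := fP n n0 in conj fi f1).
exists f; split => //.
- by have [n /fP[_ f1 _] ->] := fE _ (root1_vert _).
- by have [n /fP[_ _ f2] ->] := fE _ (root2_vert _).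
Qed.

End agree_vecGr.

Lemma agree1_le R Delta (c1 c2 : Gr R Delta) m n :
  (m <= n)%N -> agree1 c1 c2 n -> agree1 c1 c2 m.
Proof.
move=> mn [f [fi fo]]; exists f; split => //.
exact: gball_iso_le (root_vert _) mn fi fo.
Qed.

(** If [x] and [y] do not agree at [n], then every radius of agreement is at
    most [n], and so is their supremum. *)
Lemma agree_of_dist_lt (R : realType) (T : eqType)
    (agree : T -> T -> set nat) x y n :
    (forall m n, (m <= n)%N -> agree x y n -> agree x y m) ->
    (forall m, agree x x m) ->
  agree_dist R agree x y < 2 `^ (- n%:R) -> agree x y n.
Proof.
move=> ale axx; rewrite /agree_dist; case: eqP => [<- _|_]; first exact: axx.
move=> xyn; apply: contrapT => nxy; move: xyn; apply/negP; rewrite -leNgt.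
apply: ler_powR; rewrite ?ler1n// lerN2.
set S := (X in sup X); have [->|/set0P S0] := eqVneq S set0.
  (* the supremum of the empty set is 0 *)
  by rewrite sup0 ler0n.
apply: ge_sup => // _ [m /= xym <-]; rewrite ler_nat leqNgt; apply/negP => nm.
exact/nxy/(ale _ _ (ltnW nm)).
Qed.

Lemma nbhs_agree1 R Delta (c : Gr R Delta) n : nbhs c [set c' | agree1 c c' n].
Proof.
apply/nbhs_ballP; exists (2 `^ (- n%:R)) => /=; first exact: powR_gt0.
move=> c'; rewrite ballEmdist /=; apply: agree_of_dist_lt.
  by move=> *; apply: agree1_le; eassumption.
by move=> m; exact: iso1_refl.
Qed.

Lemma nbhs_agree2 R Delta (Delta_gt0 : (0 < Delta)%N) (c : vecGr R Delta_gt0) n :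
  nbhs c [set c' | agree2 c c' n].
Proof.
apply/nbhs_ballP; exists (2 `^ (- n%:R)) => /=; first exact: powR_gt0.
move=> c'; rewrite ballEmdist /=; apply: agree_of_dist_lt.
  by move=> *; apply: agree2_le; eassumption.
by move=> m; right; exact: iso2_refl.
Qed.

(** Agreement at radius [n] bounds the distance by [2 ^ - n] because distinct
    classes agree only up to a bounded radius, by [agree2_sep]; the supremum of
    an unbounded set would be [0] and the distance [1]. *)
Lemma agree2_sub_open R Delta (Delta_gt0 : (0 < Delta)%N)
    (U : set (vecGr R Delta_gt0)) c :
  open U -> U c -> exists n, [set c' | agree2 c c' n] `<=` U.
Proof.
rewrite openE => Uo Uc; have /nbhs_ballP[e /= e0 eU] := Uo _ Uc.
(* the radius is chosen so that 1 / e < 2 ^ n *)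
exists (Num.bound e^-1) => c' acc'; apply: eU; rewrite ballEmdist /=.
rewrite /mdist /=; have [->|cc'] := eqVneq c c'; first by rewrite agree_distxx.
have [m [_ mmax ->]] := agree_dist_eq R (fun _ _ => or_introl erefl)
  (@agree2_le R Delta Delta_gt0) (@agree2_sep R Delta Delta_gt0) cc'.
rewrite powRN powR_mulrn// -[ltRHS]invrK ltf_pV2 ?posrE ?invr_gt0 ?exprn_gt0//.
exact/upper_nthrootP/mmax.
Qed.

(** * Edges at the root *)

(** Around a neighbour of the root, the ball of radius [n] lies inside the ball
    of radius [n + 1] around the root.  The same isomorphism therefore serves at
    the root, for outgoing edges, and at the neighbour, for incoming ones. *)
Lemma agree_neighbours (R : realType) Delta (Delta_gt0 : (0 < Delta)%N)
    (G H : rooted Delta) n :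
    iso1 (gball G (root G) n.+1) (root G) (gball H (root H) n.+1) (root H) ->
  exists h : {x | adj G (root G) x} -> {x | adj H (root H) x},
  [/\ bijective h,
   forall x, agree2 (class2 R Delta_gt0 (outgoing x))
                    (class2 R Delta_gt0 (outgoing (h x))) n
 & forall x, agree2 (class2 R Delta_gt0 (incoming x))
                    (class2 R Delta_gt0 (incoming (h x))) n].
Proof.
move=> [f [fi fo]]; have [g [gi gf fg]] := graph_iso_inv fi.
have BG := gball_root n.+1 (root_vert G); have BH := gball_root n.+1 (root_vert H).
have go : g (root H) = root G by rewrite -fo gf.
have nG x : adj G (root G) x -> vert (gball G (root G) n.+1) x by exact: gball_nbr.
have nH x : adj H (root H) x -> vert (gball H (root H) n.+1) x by exact: gball_nbr.
have fadj x : adj G (root G) x -> adj H (root H) (f x).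
  move=> ox; have [[fV _ _] fa] := fi.
  rewrite -(adj_gball BH (fV _ (nG _ ox))) -[X in adj _ X _]fo fa//; last exact: nG.
  by rewrite adj_gball//; exact: nG.
have gadj x : adj H (root H) x -> adj G (root G) (g x).
  move=> ox; have [[gV _ _] ga] := gi.
  rewrite -(adj_gball BG (gV _ (nH _ ox))) -[X in adj _ X _]go ga//; last exact: nH.
  by rewrite adj_gball//; exact: nH.
exists (fun x => exist _ (f (sval x)) (fadj _ (svalP x))); split.
- exists (fun y => exist _ (g (sval y)) (gadj _ (svalP y))).
  + by move=> [x Gx]; apply: val_inj => /=; apply: gf; exact: nG.
  + by move=> [y Hy]; apply: val_inj => /=; apply: fg; exact: nH.
- move=> [x Gx]; apply: (@agree2_of_iso _ _ _ _ _ f) => //=.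
  exact: gball_iso_le (root_vert _) (leqnSn n) fi fo.
- move=> [x Gx]; apply: (@agree2_of_iso _ _ _ _ _ f) => //=.
  apply: (gball_induced_iso fi) => [|y|y]; first exact: adj_vertr Gx.
  - exact: within_cons.
  - by apply: within_cons; exact: fadj.
Qed.

Section sums.
Context (R : realType) (Delta : nat) (Delta_gt0 : (0 < Delta)%N).

Lemma card_nbr (G : rooted Delta) :
  ([set: {x | adj G (root G) x}] #<= `I_Delta)%card.
Proof.
apply: card_le_trans (rooted_degree G _ (root_vert G)).
have <- : (fun x : {x | adj G (root G) x} => sval x) @^-1` nbr G (root G) = setT.
  by apply/seteqP; split => // -[].
by apply: card_ge_preimage => x y _ _; exact: val_inj.
Qed.

Definition in_edges (c : Gr R Delta) : seq (vecGr R Delta_gt0) :=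
  [seq class2 R Delta_gt0 (incoming x)
  | x <- fset_set [set: {x | adj (repr1 c) (root (repr1 c)) x}]].

Definition out_edges (c : Gr R Delta) : seq (vecGr R Delta_gt0) :=
  [seq class2 R Delta_gt0 (outgoing x)
  | x <- fset_set [set: {x | adj (repr1 c) (root (repr1 c)) x}]].

Lemma finite_nbr (G : rooted Delta) : finite_set [set: {x | adj G (root G) x}].
Proof. exact: card_le_finite (card_nbr G) (finite_II _). Qed.

Lemma in_sumE_edges (f : vecGr R Delta_gt0 -> R) c :
  in_sum f c = \sum_(y <- in_edges c) f y.
Proof. by rewrite big_map -fsbig_finite//; exact: finite_nbr. Qed.

Lemma out_sumE_edges (f : vecGr R Delta_gt0 -> R) c :
  out_sum f c = \sum_(y <- out_edges c) f y.
Proof. by rewrite big_map -fsbig_finite//; exact: finite_nbr. Qed.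

Lemma size_in_edges c : (size (in_edges c) <= Delta)%N.
Proof. by rewrite size_map; apply: geq_card_fset_set; exact: card_nbr. Qed.

Lemma size_out_edges c : (size (out_edges c) <= Delta)%N.
Proof. by rewrite size_map; apply: geq_card_fset_set; exact: card_nbr. Qed.

Lemma agree1_sums (f : vecGr R Delta_gt0 -> R) n :
    (forall c1 c2, agree2 c1 c2 n -> f c1 = f c2) ->
  forall c1 c2, agree1 c1 c2 n.+1 ->
    in_sum f c1 = in_sum f c2 /\ out_sum f c1 = out_sum f c2.
Proof.
move=> fn c1 c2 /(agree_neighbours R Delta_gt0)[h [hb ho hi]].
rewrite /in_sum /in_sum_of [in X in _ = X /\ _](reindex_fsbigT h)//.
rewrite /out_sum /out_sum_of [in X in _ /\ _ = X](reindex_fsbigT h)//.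
by split; apply: eq_fsbigr => x _; exact: fn.
Qed.

End sums.

(** * Passage to the weak limit *)

Definition locally_constant (T : topologicalType) (Z : Type) (g : T -> Z) :=
  forall c, nbhs c [set c' | g c = g c'].

Lemma locally_constant_open (T : topologicalType) (Z : Type) (g : T -> Z)
    (A : set Z) :
  locally_constant g -> open (g @^-1` A).
Proof.
by move=> gl; rewrite openE => c Ac; apply: filterS (gl c) => c' /= <-.
Qed.

Lemma locally_constant_continuous (T Z : topologicalType) (g : T -> Z) :
  locally_constant g -> continuous g.
Proof. by move=> gl; apply/continuousP => A _; exact: locally_constant_open. Qed.

Section weak_limit.
Context (R : realType) (Delta : nat) (Delta_gt0 : (0 < Delta)%N).
Implicit Types (f : vecGr R Delta_gt0 -> R) (mu : probability (Gr R Delta) R).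

Let ins : Gr R Delta -> seq (vecGr R Delta_gt0) := @in_edges R Delta Delta_gt0.
Let outs : Gr R Delta -> seq (vecGr R Delta_gt0) := @out_edges R Delta Delta_gt0.

Lemma seq_sum_in f : seq_sum ins (EFin \o f) = EFin \o in_sum f.
Proof. by apply/funext => c; rewrite /seq_sum sumEFin /= in_sumE_edges. Qed.

Lemma seq_sum_out f : seq_sum outs (EFin \o f) = EFin \o out_sum f.
Proof. by apply/funext => c; rewrite /seq_sum sumEFin /= out_sumE_edges. Qed.

(** Both sums are locally constant, hence continuous, so that weak convergence
    applies to them; for each [mu_ n] the two integrals coincide, and limits are
    unique. *)
Lemma balanced_finite_range (mu_ : nat -> probability (Gr R Delta) R) mu f n :
    (forall m, unimodular Delta_gt0 (mu_ m)) -> weak_cvg mu_ mu ->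
    (forall c, 0 <= f c) ->
    (forall c1 c2, agree2 c1 c2 n -> f c1 = f c2) ->
  balanced mu ins outs (EFin \o f).
Proof.
move=> mu_unimodular mu_cvg f0 fn.
have li : locally_constant (in_sum f).
  by move=> c; apply: filterS (nbhs_agree1 c n.+1) => c' /(agree1_sums fn)[].
have lo : locally_constant (out_sum f).
  by move=> c; apply: filterS (nbhs_agree1 c n.+1) => c' /(agree1_sums fn)[].
have mf : measurable_fun setT f.
  move=> _ A mA; rewrite setTI; apply: sub_sigma_algebra.
  apply: locally_constant_open => c.
  by apply: filterS (nbhs_agree2 c n) => c' /fn.
have mE (g : Gr R Delta -> R) :
    locally_constant g -> measurable_fun setT (EFin \o g).
  move=> gl _ A mA; rewrite setTI; apply: sub_sigma_algebra.
  apply: locally_constant_open => c.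
  by apply: filterS (gl c) => c' /= ->.
split; rewrite ?seq_sum_in ?seq_sum_out; [exact: mE|exact: mE|].
have /cvg_lim <- // := mu_cvg _ (locally_constant_continuous li).
have /cvg_lim <- // := mu_cvg _ (locally_constant_continuous lo).
by congr (limn _); apply/funext => m; exact: mu_unimodular.
Qed.

(** The sets [U_ n] below exhaust [U] because agreement at radius [n] describes
    a neighbourhood basis, and each is a union of classes of agreement at
    radius [n], since these classes are either equal or disjoint. *)
Lemma balanced_open mu (U : set (vecGr R Delta_gt0)) :
    (forall f n, (forall c, 0 <= f c) ->
       (forall c1 c2, agree2 c1 c2 n -> f c1 = f c2) ->
     balanced mu ins outs (EFin \o f)) ->
  open U -> balanced mu ins outs (fun c => (\1_U c)%:E).
Proof.
move=> bal oU.
pose U_ n : set (vecGr R Delta_gt0) := [set c | [set c' | agree2 c c' n] `<=` U].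
have U_U n : U_ n `<=` U by move=> c; apply; right; exact: iso2_refl.
have U_le m n : (m <= n)%N -> U_ m `<=` U_ n.
  by move=> mn c cU c' cc'; apply: cU; exact: agree2_le cc'.
apply: (@balanced_lim _ _ _ _ _ _ _ _ (fun n c => (\1_(U_ n) c)%:E)).
- by move=> n c; rewrite lee_fin.
- move=> c m n mn; rewrite lee_fin !indicE ler_nat.
  by have [/set_mem/(U_le _ _ mn)/mem_set ->|//] := boolP (c \in U_ m).
- move=> c; apply: cvg_near_cst.
  have [Uc|nUc] := pselect (U c); last first.
    apply: nearW => n; rewrite !indicE !memNset//.
    by apply: contra_not nUc; exact: U_U.
  have [n nU] := agree2_sub_open oU Uc; exists n => // m /= nm.
  by rewrite !indicE !mem_set//; exact: U_le nm _ nU.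
move=> n; apply: (bal (\1_(U_ n)) n) => // c1 c2 c12.
rewrite !indicE; congr (nat_of_bool _)%:R.
apply/idP/idP => /set_mem cU; apply/mem_set => c' cc'; apply: cU.
  exact: agree2_trans c12 cc'.
exact: agree2_trans (agree2_sym c12) cc'.
Qed.

End weak_limit.

Theorem corollary4p11 (R : realType) (Delta : nat) (Delta_gt0 : (0 < Delta)%N)
    (mu_ : nat -> probability (Gr R Delta) R) (mu : probability (Gr R Delta) R)
    (mu_unimodular : forall n, unimodular Delta_gt0 (mu_ n))
    (mu_cvg : weak_cvg mu_ mu) :
  unimodular Delta_gt0 mu.
Proof.
move=> f mf f0.
have bal (U : set (vecGr R Delta_gt0)) : open U ->
    balanced mu (@in_edges R Delta Delta_gt0) (@out_edges R Delta Delta_gt0)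
      (fun c => (\1_U c)%:E).
  apply: balanced_open => g n g0 gn.
  exact: balanced_finite_range mu_unimodular mu_cvg g0 gn.
have [_ _] : balanced mu (@in_edges R Delta Delta_gt0)
    (@out_edges R Delta Delta_gt0) (EFin \o f).
  have := @balanced_measurable _ _ _ _ R mu (@in_edges R Delta Delta_gt0)
    (@out_edges R Delta Delta_gt0) Delta open
    (@size_in_edges R Delta Delta_gt0) (@size_out_edges R Delta Delta_gt0) erefl
    (@openI _) openT bal.
  apply; first exact/measurable_EFinP.
  by move=> y; rewrite lee_fin.
by rewrite seq_sum_in seq_sum_out.
Qed.
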